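(* Let $N\geq 1$, let $m_I,m_E\geq 0$ be integers with $m=m_I+m_E\geq 1$, and let $q_i(x)=x^\top A_i x+2b_i^\top x+c_i$ ($i=0,\dots,m$) be quadratic functions on $\mathbb{R}^N$ with $A_i\in\mathbb{S}^N$, $b_i\in\mathbb{R}^N$, $c_i\in\mathbb{R}$. Let $\mathcal{D}$, $\mathcal{D}_{\mathrm{SDP}}$, $\Gamma$, $A(\gamma)$, $b(\gamma)$, semidefinite faces and the quadratic eigenvalue multiplicity $k$ be as defined in the context. Suppose that: (1) the set $\{x\in\mathbb{R}^N : q_i(x)\leq 0 \text{ for } i=1,\dots,m_I,\ q_i(x)=0 \text{ for } i=m_I+1,\dots,m\}$ is nonempty, and there exists $\gamma^*\in\mathbb{R}^m$ with $\gamma^*_i\geq 0$ for all $i=1,\dots,m_I$ and $A_0+\sum_{i=1}^m\gamma_i^*A_i\succ 0$; (2) $\Gamma$ is polyhedral. If for every semidefinite face $\mathcal{F}$ of $\Gamma$ we have $$k\geq \operatorname{aff\,dim}(\{b(\gamma):\gamma\in\mathcal{F}\})+1,$$ then $\operatorname{conv}(\mathcal{D})=\mathcal{D}_{\mathrm{SDP}}$.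
   Context: $\mathbb{S}^N$ denotes the real symmetric $N\times N$ matrices; $\operatorname{conv}$ is the convex hull; $\operatorname{aff\,dim}$ is the affine dimension (dimension of the affine hull); $\otimes$ is the Kronecker product; $I_k$ is the $k\times k$ identity matrix. Epigraph of the QCQP: $\mathcal{D}=\{(x,t)\in\mathbb{R}^N\times\mathbb{R} : q_0(x)\leq 2t,\ q_i(x)\leq 0\ (1\leq i\leq m_I),\ q_i(x)=0\ (m_I+1\leq i\leq m)\}$. Projected epigraph of the SDP relaxation: let $Q_i=\begin{pmatrix}c_i & b_i^\top\\ b_i & A_i\end{pmatrix}\in\mathbb{S}^{N+1}$. Then $\mathcal{D}_{\mathrm{SDP}}$ is the set of $(x,t)\in\mathbb{R}^{N+1}$ for which there exists $X\in\mathbb{S}^N$ such that $Y=\begin{pmatrix}1&x^\top\\ x&X\end{pmatrix}$ satisfies $Y\succeq 0$, $\langle Q_0,Y\rangle\leq 2t$, $\langle Q_i,Y\rangle\leq 0$ for $1\leq i\leq m_I$, and $\langle Q_i,Y\rangle=0$ for $m_I+1\leq i\leq m$. For $\gamma\in\mathbb{R}^m$: $A(\gamma)=A_0+\sum_{i=1}^m\gamma_iA_i$ and $b(\gamma)=b_0+\sum_{i=1}^m\gamma_ib_i$. The dual object is $\Gamma=\{\gamma\in\mathbb{R}^m : A(\gamma)\succeq 0,\ \gamma_i\geq 0\ (1\leq i\leq m_I)\}$. A face $\mathcal{F}$ of $\Gamma$ is definite if there exists $\gamma\in\mathcal{F}$ with $A(\gamma)\succ 0$; otherwise it is semidefinite.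 The quadratic eigenvalue multiplicity of the QCQP is the largest integer $k$ (necessarily a divisor of $N$; write $N=nk$) such that for every $i\in\{0,1,\dots,m\}$ there exists $\mathcal{A}_i\in\mathbb{S}^n$ with $A_i=I_k\otimes\mathcal{A}_i$. *)

(* Defs.v *)
From mathcomp Require Import all_boot all_order all_algebra.
From mathcomp Require Import boolp classical_sets reals interval_inference convex.
From mathcomp Require Import mxtens.

Set Implicit Arguments.
Unset Strict Implicit.
Unset Printing Implicit Defensive.

Import Order.TTheory GRing.Theory Num.Theory.

Local Open Scope classical_set_scope.
Local Open Scope ring_scope.

Definition psd (R : realType) (n : nat) (M : 'M[R]_n) : Prop :=
  M^T = M /\ forall x : 'cV[R]_n, 0 <= (x^T *m M *m x) 0 0.

Definition posdef (R : realType) (n : nat) (M : 'M[R]_n) : Prop :=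
  M^T = M /\ forall x : 'cV[R]_n, x != 0 -> 0 < (x^T *m M *m x) 0 0.

Definition mxdot (R : realType) (n : nat) (M M' : 'M[R]_n) : R :=
  \tr (M^T *m M').

Definition convex_hull (R : realType) (E : lmodType R) (S : set E) : set E :=
  smallest (@convex_set R E) S.

Definition affine_set (R : realType) (E : lmodType R) (S : set E) : Prop :=
  forall (x y : E) (t : R), S x -> S y -> S (t *: x + (1 - t) *: y).

Definition affine_hull (R : realType) (E : lmodType R) (S : set E) : set E :=
  smallest (@affine_set R E) S.

(* [aff_dim set0 = -1]; otherwise the affine hull is a translate of a unique
   linear subspace, whose dimension is taken; see [aff_directionP] and
   [aff_dimE]. *)
Definition aff_direction (R : realType) (E : vectType R) (S : set E) :
    {vspace E} :=
  xget 0%VS [set V : {vspace E} |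
    exists x : E, affine_hull S = [set x + v | v in [set v | v \in V]]].

Definition aff_dim (R : realType) (E : vectType R) (S : set E) : int :=
  if `[< S = set0 >] then -1 else (\dim (aff_direction S))%:Z.

Lemma affine_hull_affine (R : realType) (E : lmodType R) (S : set E) :
  affine_set (affine_hull S).
Proof.
by move=> x y t xS yS A cA; apply: (cA.1); [exact: xS|exact: yS].
Qed.

Lemma sub_affine_hull (R : realType) (E : lmodType R) (S : set E) :
  S `<=` affine_hull S.
Proof. by move=> x Sx A [_]; exact. Qed.

Lemma aff_directionP (R : realType) (E : vectType R) (S : set E) :
  S !=set0 -> exists x : E,
    affine_hull S = [set x + v | v in [set v | v \in aff_direction S]].
Proof.
move=> [x0 Sx0].
suff: [set V : {vspace E} | exists x : E,
    affine_hull S = [set x + v | v in [set v | v \in V]]] !=set0.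
  by move=> [V PV]; rewrite /aff_direction; case: xgetP => [W _ //|/(_ V)].
have Haff := @affine_hull_affine R E S; set H := affine_hull S in Haff *.
have Hx0 : H x0 by exact: sub_affine_hull.
pose L v := H (x0 + v).
have LZ t v : L v -> L (t *: v).
  move=> Lv; rewrite /L; have -> : x0 + t *: v = t *: (x0 + v) + (1 - t) *: x0.
    by rewrite scalerDr addrAC -scalerDl [t + _]addrC subrK scale1r.
  exact: Haff.
have LD u v : L u -> L v -> L (u + v).
  move=> Lu Lv; rewrite /L.
  have -> : x0 + (u + v) =
      2^-1 *: (x0 + 2 *: u) + (1 - 2^-1) *: (x0 + 2 *: v).
    have e : 1 - 2^-1 = 2^-1 :> R.
      by apply/eqP; rewrite subr_eq -[X in _ == X + _]mul1r
        -[X in _ == _ + X]mul1r -mulrDl divff ?pnatr_eq0.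
    rewrite e !scalerDr !scalerA mulVf ?pnatr_eq0// !scale1r addrACA -scalerDl.
    by rewrite -{1}e subrK scale1r.
  by apply: Haff; apply: LZ.
pose P n := `[< exists2 V : {vspace E},
  \dim V = n & forall v, v \in V -> L v >].
have exP : exists n, P n.
  exists 0%N; apply/asboolP; exists 0%VS; first by rewrite dimv0.
  by move=> v; rewrite memv0 => /eqP ->; rewrite /L addr0.
have leP n : P n -> (n <= \dim {:E})%N.
  by move=> /asboolP[V <- _]; exact/dimvS/subvf.
case: (ex_maxnP exP leP) => n /asboolP[V dV LV] maxn.
exists V, x0; apply/seteqP; split=> [y Hy|_ [v /= vV <-]]; last exact: LV.
exists (y - x0); last by rewrite addrC subrK.
have Ly : L (y - x0) by rewrite /L addrC subrK.
apply/negP => /negP nyV.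
have /maxn : P (\dim (V + <[y - x0]>)%VS).
  apply/asboolP; exists (V + <[y - x0]>)%VS => // v /memv_addP[a aV [b bl ->]].
  by move/vlineP: bl => [c ->]; apply: LD; [exact: LV|exact: LZ].
rewrite -dV; apply/negP; rewrite -ltnNge ltn_neqAle (eqn_leq (\dim V)).
rewrite (dimvS (addvSl _ _))/= andbT.
apply: contra nyV => le.
have /eqP -> : V == (V + <[y - x0]>)%VS by rewrite eqEdim addvSl.
exact/(subvP (addvSr _ _))/memv_line.
Qed.

Lemma aff_dimE (R : realType) (E : vectType R) (S : set E) (x : E)
    (V : {vspace E}) :
  affine_hull S = [set x + v | v in [set v | v \in V]] ->
  aff_dim S = (\dim V)%:Z.
Proof.
move=> SV; rewrite /aff_dim; case: asboolP => [S0|/eqP/set0P S0].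
  have : affine_hull S `<=` set0.
    by move=> y; apply; split=> [? ? ? []|]; rewrite S0.
  rewrite SV => /(_ x); case; exists 0; last by rewrite addr0.
  exact: mem0v.
have [y SW] := aff_directionP S0; congr (Posz (\dim _)).
have key (a b : E) (U W : {vspace E}) :
    [set a + v | v in [set v | v \in U]] =
    [set b + v | v in [set v | v \in W]] -> (U <= W)%VS.
  move=> UW; apply/subvP => v vU.
  have [w wW wE] : [set b + v | v in [set v | v \in W]] (a + v).
    by rewrite -UW; exists v.
  have [w0 w0W w0E] : [set b + v | v in [set v | v \in W]] a.
    by rewrite -UW; exists 0; [exact: mem0v|rewrite addr0].
  have -> : v = w - w0.
    by apply: (addrI a); rewrite -wE -{1}w0E -addrA [w0 + _]addrC subrK.
  exact: memvB.
by apply/eqP; rewrite eqEsubv (key y x) ?(key x y)// -SV -SW.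
Qed.

Definition polyhedral (R : realType) (n : nat) (S : set 'cV[R]_n) : Prop :=
  exists (p : nat) (P : 'M[R]_(p, n)) (r : 'cV[R]_p),
    S = [set x | forall i : 'I_p, (P *m x) i 0 <= r i 0].

Definition face (R : realType) (E : lmodType R) (C F : set E) : Prop :=
  [/\ F `<=` C, convex_set (F : set (convex_lmodType E)) &
      forall (x y : E) (t : R), C x -> C y -> 0 < t < 1 ->
        F (t *: x + (1 - t) *: y) -> F x /\ F y].

Record quadratic (R : realType) (N : nat) := Quadratic {
  qmat : 'M[R]_N;
  qvec : 'cV[R]_N;
  qcst : R;
  qmat_sym : qmat^T = qmat }.

Definition qeval (R : realType) (N : nat) (q : quadratic R N)
    (x : 'cV[R]_N) : R :=
  (x^T *m qmat q *m x) 0 0 + 2 * ((qvec q)^T *m x) 0 0 + qcst q.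

Definition qhom (R : realType) (N : nat) (q : quadratic R N) : 'M[R]_(1 + N) :=
  block_mx (qcst q)%:M (qvec q)^T (qvec q) (qmat q).

(* A QCQP is given by an objective [q0] and constraints [q i], which are
   inequalities for [i < mI] and equalities for [mI <= i]. *)
Definition feasible (R : realType) (N mI mE : nat)
    (q : 'I_(mI + mE) -> quadratic R N) : set 'cV[R]_N :=
  [set x | (forall i : 'I_(mI + mE), (i < mI)%N -> qeval (q i) x <= 0) /\
           (forall i : 'I_(mI + mE), (mI <= i)%N -> qeval (q i) x = 0)].

Definition epigraph (R : realType) (N mI mE : nat) (q0 : quadratic R N)
    (q : 'I_(mI + mE) -> quadratic R N) : set ('cV[R]_N * R^o) :=
  [set xt | qeval q0 xt.1 <= 2 * xt.2 /\ feasible q xt.1].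

Definition epigraph_sdp (R : realType) (N mI mE : nat) (q0 : quadratic R N)
    (q : 'I_(mI + mE) -> quadratic R N) : set ('cV[R]_N * R^o) :=
  [set xt | exists X : 'M[R]_N, X^T = X /\
     let Y : 'M[R]_(1 + N) := block_mx 1%:M xt.1^T xt.1 X in
     [/\ psd Y,
         mxdot (qhom q0) Y <= 2 * xt.2,
         forall i : 'I_(mI + mE), (i < mI)%N -> mxdot (qhom (q i)) Y <= 0 &
         forall i : 'I_(mI + mE), (mI <= i)%N -> mxdot (qhom (q i)) Y = 0]].

Definition Agamma (R : realType) (N m : nat) (q0 : quadratic R N)
    (q : 'I_m -> quadratic R N) (g : 'cV[R]_m) : 'M[R]_N :=
  qmat q0 + \sum_(i < m) g i 0 *: qmat (q i).

Definition bgamma (R : realType) (N m : nat) (q0 : quadratic R N)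
    (q : 'I_m -> quadratic R N) (g : 'cV[R]_m) : 'cV[R]_N :=
  qvec q0 + \sum_(i < m) g i 0 *: qvec (q i).

Definition Gamma (R : realType) (N mI mE : nat) (q0 : quadratic R N)
    (q : 'I_(mI + mE) -> quadratic R N) : set 'cV[R]_(mI + mE) :=
  [set g | psd (Agamma q0 q g) /\
           forall i : 'I_(mI + mE), (i < mI)%N -> 0 <= g i 0].

Definition definite (R : realType) (N m : nat) (q0 : quadratic R N)
    (q : 'I_m -> quadratic R N) (F : set 'cV[R]_m) : Prop :=
  exists2 g, F g & posdef (Agamma q0 q g).

Definition semidefinite (R : realType) (N m : nat) (q0 : quadratic R N)
    (q : 'I_m -> quadratic R N) (F : set 'cV[R]_m) : Prop :=
  ~ definite q0 q F.

Definition kron_id_sym (R : realType) (N k n : nat) (e : (k * n)%N = N)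
    (A : 'M[R]_N) : Prop :=
  exists2 B : 'M[R]_n, B^T = B & A = castmx (e, e) ((1%:M : 'M[R]_k) *t B).

Definition kron_decomposable (R : realType) (N m : nat) (q0 : quadratic R N)
    (q : 'I_m -> quadratic R N) (k : nat) : Prop :=
  exists (n : nat) (e : (k * n)%N = N),
    kron_id_sym e (qmat q0) /\ forall i : 'I_m, kron_id_sym e (qmat (q i)).

Definition is_quad_eig_mult (R : realType) (N m : nat) (q0 : quadratic R N)
    (q : 'I_m -> quadratic R N) (k : nat) : Prop :=
  kron_decomposable q0 q k /\
  forall k' : nat, kron_decomposable q0 q k' -> (k' <= k)%N.

Lemma quad_eig_mult_exists (R : realType) (N m : nat) (q0 : quadratic R N)
    (q : 'I_m -> quadratic R N) :
  (0 < N)%N -> exists k, is_quad_eig_mult q0 q k.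
Proof.
move=> N0; pose P k := `[< kron_decomposable q0 q k >].
have P1 : P 1%N.
  have main (p : quadratic R N) : kron_id_sym (mul1n N) (qmat p).
    exists (qmat p); first exact: qmat_sym.
    apply/matrixP => i j; rewrite castmxE /tensmx !mxE.
    rewrite !ord1 eqxx mul1r; congr (qmat p _ _); apply/val_inj => /=;
      by rewrite modn_small.
  by apply/asboolP; exists N, (mul1n N).
have leP k : P k -> (k <= N)%N.
  by move=> /asboolP[[|n] [e _]]; [move: N0; rewrite -e muln0|
    rewrite -e leq_pmulr].
case: (ex_maxnP (ex_intro P _ P1) leP) => k /asboolP Pk maxk.
by exists k; split=> // k' /asboolP; exact: maxk.
Qed.

(* Main.v *)
Require Import Defs.
From HB Require Import structures.
From mathcomp Require Import all_boot all_order all_algebra.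
From mathcomp Require Import boolp classical_sets reals interval_inference convex.
From mathcomp Require Import mxtens.
From mathcomp Require Import ring lra.

(** The set [Gamma], being polyhedral, homogenises to a finitely generated cone;
    let [E] be the set of points [(x, t)] satisfying the Lagrangian inequality of
    each of its generators. Weak duality gives [epigraph_sdp `<=` E]. To see that
    [E] lies in the convex hull of the epigraph, consider a point of [E] and the
    face [F] of [Gamma] formed by the multipliers for which the inequality is
    tight. If [F] is definite, a small perturbation of a definite multiplier in
    [F] shows that the point is in the epigraph. Otherwise all [A(gamma)], for
    [gamma] in [F], share a kernel vector, hence, by the Kronecker structure, a
    [k]-dimensional space of them; as [b(F)] has affine dimension less than [k],
    one of them, [d], has constant product with [b(gamma)] on [F]. Along [d], with
    [t] varying affinely, the whole of [F] stays tight, and moving both ways until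
    a new generator becomes tight writes the point as a convex combination of two
    points with more tight generators. No strong duality is involved. *)

Set Implicit Arguments.
Unset Strict Implicit.
Unset Printing Implicit Defensive.

Import Order.TTheory GRing.Theory Num.Theory.

Local Open Scope classical_set_scope.
Local Open Scope ring_scope.

(** * Positive semidefinite matrices *)

Definition mxform (R : realType) (n : nat) (M : 'M[R]_n) (x y : 'cV[R]_n) : R :=
  (x^T *m M *m y) 0 0.

Lemma mxformDl (R : realType) n (M : 'M[R]_n) x y z :
  mxform M (x + y) z = mxform M x z + mxform M y z.
Proof. by rewrite /mxform linearD /= !mulmxDl mxE. Qed.

Lemma mxformDr (R : realType) n (M : 'M[R]_n) x y z :
  mxform M z (x + y) = mxform M z x + mxform M z y.
Proof. by rewrite /mxform !mulmxDr mxE. Qed.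

Lemma mxformZl (R : realType) n (M : 'M[R]_n) a x z :
  mxform M (a *: x) z = a * mxform M x z.
Proof. by rewrite /mxform linearZ /= -!scalemxAl mxE. Qed.

Lemma mxformZr (R : realType) n (M : 'M[R]_n) a x z :
  mxform M z (a *: x) = a * mxform M z x.
Proof. by rewrite /mxform -!scalemxAr mxE. Qed.

Lemma mxformC (R : realType) n (M : 'M[R]_n) x y :
  M^T = M -> mxform M x y = mxform M y x.
Proof.
move=> sM; rewrite /mxform -[in RHS](trmxK (y^T *m M *m x)) [RHS]mxE.
by rewrite !trmx_mul sM trmxK mulmxA.
Qed.

Lemma mxform_addm (R : realType) n (M M' : 'M[R]_n) x y :
  mxform (M + M') x y = mxform M x y + mxform M' x y.
Proof. by rewrite /mxform mulmxDr mulmxDl mxE. Qed.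

Lemma mxform_scalem (R : realType) n a (M : 'M[R]_n) x y :
  mxform (a *: M) x y = a * mxform M x y.
Proof. by rewrite /mxform -scalemxAr -scalemxAl mxE. Qed.

Lemma mxform_summ (R : realType) n (I : finType) (P : pred I) (M : I -> 'M[R]_n)
    x y :
  mxform (\sum_(i | P i) M i) x y = \sum_(i | P i) mxform (M i) x y.
Proof. by rewrite /mxform mulmx_sumr mulmx_suml summxE. Qed.

Lemma mxform_mul0 (R : realType) n (M : 'M[R]_n) x y :
  M *m y = 0 -> mxform M x y = 0.
Proof. by move=> My; rewrite /mxform -mulmxA My mulmx0 mxE. Qed.

Lemma mxform_deltal (R : realType) n (M : 'M[R]_n) i y :
  mxform M (delta_mx i 0) y = (M *m y) i 0.
Proof. by rewrite /mxform trmx_delta -mulmxA -rowE mxE. Qed.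

Lemma mxform_delta (R : realType) n (M : 'M[R]_n) i :
  mxform M (delta_mx i 0) (delta_mx i 0) = M i i.
Proof. by rewrite mxform_deltal -colE mxE. Qed.

Lemma mxform_sqr (R : realType) n (M : 'M[R]_n) x y (s t : R) : M^T = M ->
  mxform M (s *: x + t *: y) (s *: x + t *: y) =
  s ^+ 2 * mxform M x x + 2 * s * t * mxform M x y + t ^+ 2 * mxform M y y.
Proof.
move=> sM; rewrite mxformDl !mxformDr !mxformZl !mxformZr (mxformC y x sM).
by ring.
Qed.

Lemma psd_cauchy_schwarz (R : realType) n (M : 'M[R]_n) x y : psd M ->
  mxform M x y ^+ 2 <= mxform M x x * mxform M y y.
Proof.
case=> sM pM.
have sq s t : 0 <= s ^+ 2 * mxform M x x + 2 * s * t * mxform M x y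
    + t ^+ 2 * mxform M y y by rewrite -mxform_sqr //; exact: pM.
have a0 : 0 <= mxform M x x by exact: pM.
have c0 : 0 <= mxform M y y by exact: pM.
move: (mxform M x x) (mxform M x y) (mxform M y y) sq a0 c0 => a b c sq a0 c0.
rewrite -subr_ge0.
(* The determinant [a * c - b ^+ 2] appears on testing at [(s, t) = (c, -b)], or at [(-b, a)] when
   [c = 0]. If both diagonal values vanish, [(1, -b)] forces [b = 0]. *)
have [c_gt0|c_le0] := ltP 0 c.
  by rewrite -(pmulr_rge0 _ c_gt0); have := sq c (- b); congr (_ <= _); ring.
have [a_gt0|a_le0] := ltP 0 a.
  by rewrite -(pmulr_rge0 _ a_gt0); have := sq (- b) a; congr (_ <= _); ring.
have -> : a = 0 by apply/le_anti/andP.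
by have := sq 1 (- b); nra.
Qed.

(** Cauchy-Schwarz against each basis vector annihilates the corresponding coordinate of
    [M *m x]. *)
Lemma psd_kernel (R : realType) n (M : 'M[R]_n) x : psd M ->
  mxform M x x = 0 -> M *m x = 0.
Proof.
move=> pM x0; apply/matrixP => i j; rewrite ord1 -mxform_deltal mxE.
have := psd_cauchy_schwarz (delta_mx i 0) x pM.
rewrite x0 mulr0 => h; apply/eqP; rewrite -sqrf_eq0 eq_le h.
exact: sqr_ge0.
Qed.

Lemma psd_add (R : realType) n (M M' : 'M[R]_n) : psd M -> psd M' -> psd (M + M').
Proof.
move=> [sM pM] [sM' pM']; split=> [|z]; first by rewrite linearD /= sM sM'.
rewrite -/(mxform _ _ _) mxform_addm; apply: addr_ge0; first exact: pM.
exact: pM'.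
Qed.

Lemma psd_sum (R : realType) n (I : finType) (P : pred I) (M : I -> 'M[R]_n) :
  (forall i, P i -> psd (M i)) -> psd (\sum_(i | P i) M i).
Proof.
move=> pM; split=> [|x].
  by rewrite linear_sum /=; apply: eq_bigr => i /pM[].
rewrite -/(mxform _ _ _) mxform_summ; apply: sumr_ge0 => i /pM[_]; exact.
Qed.

Lemma psd_scale (R : realType) n a (M : 'M[R]_n) :
  0 <= a -> psd M -> psd (a *: M).
Proof.
move=> a0 [sM pM]; split=> [|x]; first by rewrite linearZ /= sM.
by rewrite -/(mxform _ _ _) mxform_scalem mulr_ge0 //; exact: pM.
Qed.

Lemma psd_nonposdef (R : realType) n (M : 'M[R]_n) : psd M -> ~ posdef M ->
  exists2 x : 'cV[R]_n, x != 0 & M *m x = 0.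
Proof.
move=> pM; apply: contra_notP => nx; split=> [|x x0]; first by case: pM.
rewrite lt_neqAle pM.2 andbT eq_sym; apply/eqP => Mx; apply: nx.
by exists x => //; exact: psd_kernel.
Qed.

Lemma mxform_dyad (R : realType) n (c x : 'cV[R]_n) :
  mxform (c *m c^T) x x = (c^T *m x) 0 0 ^+ 2.
Proof.
rewrite /mxform mulmxA -mulmxA mxE big_ord1 expr2; congr (_ * _).
by rewrite -[x^T *m c]trmxK trmx_mul trmxK mxE.
Qed.

Lemma mxtrace_dyad (R : realType) n (M : 'M[R]_n) (c : 'cV[R]_n) :
  \tr (M *m (c *m c^T)) = mxform M c c.
Proof. by rewrite mulmxA mxtrace_mulC mulmxA trace_mx11. Qed.

(* Removing the dyad of column [i], normalised by the pivot [Z i i], keeps [Z]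
   semidefinite by Cauchy-Schwarz and clears the [i]-th diagonal entry: this
   writes [Z] as a nonnegative combination of dyads. *)
Lemma psd_trace_ge0 (R : realType) n (M Z : 'M[R]_n) :
  psd M -> psd Z -> 0 <= \tr (M *m Z).
Proof.
move=> pM; have [d] := ubnP #|[set i : 'I_n | Z i i != 0]%SET|.
elim: d Z => // d IHd Z ltd pZ.
(* A zero diagonal entry forces a zero column. Hence [Z = 0] once the diagonal vanishes, and
   subtracting the dyad keeps zero diagonal entries zero. *)
have diag0 i : Z i i = 0 -> Z *m delta_mx i 0 = 0 :> 'cV_n.
  by move=> Zi; apply: psd_kernel => //; rewrite mxform_delta.
have [i /= Zi|Zdiag] := pickP (fun i => Z i i != 0); last first.
  rewrite [Z](_ : _ = 0) ?mulmx0 ?linear0 //; apply/matrixP => i j.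
  have /matrixP/(_ i 0) : Z *m delta_mx j 0 = 0 :> 'cV_n.
    by apply: diag0; apply/eqP/negbFE/Zdiag.
  by rewrite -colE !mxE.
have Zi_ge0 : 0 <= Z i i by rewrite -mxform_delta; exact: pZ.2.
have Zi_gt0 : 0 < Z i i by rewrite lt_neqAle eq_sym Zi.
have [c cD] : exists c : 'cV_n, c = Z *m delta_mx i 0 by eexists.
have cE j : c j 0 = Z j i by rewrite cD -colE mxE.
pose Z' := Z - (Z i i)^-1 *: (c *m c^T).
have Z'E j : Z' j j = Z j j - (Z i i)^-1 * Z j i ^+ 2.
  by rewrite /Z' !mxE big_ord1 !mxE cE expr2.
have pZ' : psd Z'.
  split=> [|x].
    by rewrite /Z' linearB linearZ /= trmx_mul trmxK pZ.1.
  rewrite -/(mxform _ _ _) /Z' -scaleNr mxform_addm mxform_scalem mxform_dyad.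
  rewrite mulNr subr_ge0 ler_pdivrMl // -(mxform_delta Z i).
  apply: le_trans (psd_cauchy_schwarz _ _ pZ).
  by rewrite /mxform cD trmx_mul pZ.1.
rewrite -[Z](subrK ((Z i i)^-1 *: (c *m c^T))) -/Z' mulmxDr linearD /=.
rewrite -scalemxAr linearZ /= mxtrace_dyad addr_ge0 ?mulr_ge0 ?invr_ge0 //.
  apply: IHd => //; rewrite ltnS in ltd; apply: leq_trans ltd.
  apply: proper_card; apply/properP; split.
    apply/fintype.subsetP => j; rewrite !inE; apply: contraNN => /eqP Zj.
    rewrite Z'E Zj -(pZ.1) mxE; have /matrixP/(_ i 0) := diag0 _ Zj.
    by rewrite -colE !mxE => ->; rewrite expr0n mulr0 subr0.
  exists i; rewrite !inE // Z'E negbK expr2 mulKf ?subrr //.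
exact: pM.2.
Qed.

(* Each coordinate is the [M]-product with a fixed vector, so Cauchy-Schwarz
   bounds the squares of coordinates by the form of [M]. *)
Lemma posdef_dominates (R : realType) n (M B : 'M[R]_n) : posdef M ->
  exists2 e : R, 0 < e & forall x, e * `|mxform B x x| <= mxform M x x.
Proof.
move=> pdM; have pM : psd M.
  split=> [|x]; first exact: pdM.1.
  have [->|x0] := eqVneq x 0; last exact/ltW/pdM.2.
  by rewrite mulmx0 mxE.
have uM : M \in unitmx.
  rewrite -row_free_unit -kermx_eq0; apply/rowV0P => v /sub_kermxP vM.
  apply/eqP/negP => /negP v0; have /pdM.2 : v^T != 0 by rewrite trmx_eq0.
  by rewrite trmxK vM mul0mx mxE ltxx.
pose w i := mxform M (invmx M *m delta_mx i 0) (invmx M *m delta_mx i 0).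
have w_ge0 i : 0 <= w i by exact: pM.2.
have x_le i (x : 'cV_n) : x i 0 ^+ 2 <= w i * mxform M x x.
  have -> : x i 0 = mxform M (invmx M *m delta_mx i 0) x.
    rewrite mxformC ?pM.1 // /mxform -mulmxA mulKVmx //.
    by rewrite -colE !mxE.
  exact: psd_cauchy_schwarz.
(* Each product [|x i * x j|] is bounded by [x i ^+ 2 + x j ^+ 2], hence by [w i + w j] times the
   form of [M]. The [1] added to [C] below keeps the constant defined and positive when [C = 0]. *)
pose C := \sum_i \sum_j `|B i j| * (w i + w j).
have C_ge0 : 0 <= C.
  by do 2!apply: sumr_ge0 => ? _; rewrite mulr_ge0 ?addr_ge0.
exists (C + 1)^-1 => [|x]; first by rewrite invr_gt0 ltr_wpDl.
rewrite ler_pdivrMl ?ltr_wpDl // mulrDl mul1r.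
suff : `|mxform B x x| <= C * mxform M x x.
  by move=> /le_trans; apply; rewrite lerDl; exact: pM.2.
have -> : mxform B x x = \sum_j \sum_i x i 0 * B i j * x j 0.
  rewrite /mxform mxE; apply: eq_bigr => j _; rewrite mxE big_distrl /=.
  by apply: eq_bigr => i _; rewrite mxE.
rewrite exchange_big /C mulr_suml; apply: le_trans (ler_norm_sum _ _ _) _.
apply: ler_sum => i _; rewrite mulr_suml; apply: le_trans (ler_norm_sum _ _ _) _.
apply: ler_sum => j _; rewrite mulrAC normrM mulrC -mulrA ler_wpM2l //.
have := x_le i x; have := x_le j x.
rewrite mulrDl -(real_normK (num_real (x i 0))) -(real_normK (num_real (x j 0))).
rewrite normrM; have := sqr_ge0 (`|x i 0| - `|x j 0|).
have := normr_ge0 (x i 0); have := normr_ge0 (x j 0); nra.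
Qed.

(** * Polyhedral cones *)

Definition cone_hull (R : realType) (E : lmodType R) (I : finType)
    (G : I -> E) : set E :=
  [set z | exists2 l : I -> R, (forall i, 0 <= l i) & z = \sum_i l i *: G i].

Lemma mem_cone_hull (R : realType) (E : lmodType R) (I : finType) (G : I -> E)
    i :
  cone_hull G (G i).
Proof.
exists (fun j => (j == i)%:R) => [j|]; first exact: ler0n.
rewrite (bigD1 i) //= eqxx scale1r big1 ?addr0 // => j /negPf ->.
by rewrite scale0r.
Qed.

(* One step of the double description method: the generators of the half cone
   are those in the half space, and the points where the segments joining a
   generator outside of it to a generator inside of it cross the hyperplane. *)
Lemma cone_hull_halfspace (R : realType) (E : lmodType R) (a : {scalar E})
    (I : finType) (G : I -> E) :
  exists (J : finType) (H : J -> E),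
    cone_hull G `&` [set z | a z <= 0] = cone_hull H.
Proof.
(* Indices standing for no generator are sent to [0], which does not change the cone. *)
pose H (j : I + I * I) := match j with
  | inl i => if 0 < a (G i) then 0 else G i
  | inr (i, j) => if (0 < a (G i)) && ~~ (0 < a (G j))
                  then a (G i) *: G j - a (G j) *: G i else 0
  end.
have sumH (l : I + I * I -> R) : \sum_j l j *: H j =
    \sum_(i | ~~ (0 < a (G i))) l (inl i) *: G i +
    \sum_(i | 0 < a (G i)) \sum_(j | ~~ (0 < a (G j)))
      l (inr (i, j)) *: (a (G i) *: G j - a (G j) *: G i).
  rewrite big_sumType /=; congr (_ + _).
    rewrite [RHS]big_mkcond; apply: eq_bigr => i _ /=.
    by case: ifP; rewrite ?scaler0.
  rewrite pair_big_dep [RHS]big_mkcond; apply: eq_bigr => -[i j] _ /=.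
  by case: ifP; rewrite ?scaler0.
exists (I + I * I)%type, H; apply/seteqP; split=> [z [[l l0 zE] /= az]|z [l l0 ->]].
  pose S := \sum_(i | 0 < a (G i)) l i * a (G i).
  pose T := - \sum_(i | ~~ (0 < a (G i))) l i * a (G i).
  have ST : S <= T.
    rewrite -subr_le0 /S /T opprK; move: az; rewrite zE linear_sum /=.
    rewrite (bigID (fun i => 0 < a (G i))) /=.
    under eq_bigr do rewrite linearZ /=.
    by under [X in _ + X <= 0]eq_bigr do rewrite linearZ /=.
  have S0 : 0 <= S by apply: sumr_ge0 => i /ltW ai; rewrite mulr_ge0.
  (* If [T = 0] then [S = 0], so no generator outside the half space contributes to [z], and no
     crossing point is needed. *)
  have [T0|T0] := eqVneq T 0.
    exists (fun j => if j is inl i then l i else 0).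
      by case.
    rewrite sumH zE (bigID (fun i => 0 < a (G i))) /= addrC; congr (_ + _).
    have {}S0 : S == 0 by rewrite eq_le S0 andbT -T0.
    rewrite [RHS]big1 => [|i _]; last by rewrite big1 // => j _; rewrite scale0r.
    rewrite big1 // => i ai.
    have : l i * a (G i) == 0.
      move: S0; rewrite psumr_eq0 => [/allP/(_ i (mem_index_enum _))|j /ltW aj].
        by rewrite ai.
      by rewrite mulr_ge0.
    by rewrite mulf_eq0 (gt_eqF ai) orbF => /eqP ->; rewrite scale0r.
  have T_gt0 : 0 < T by rewrite lt_neqAle eq_sym T0 (le_trans S0).
  (* Each outer generator [i] is paired with the inner ones in proportion to their coefficients
     [l j]. The pairs restore [P] in full and use up the fraction [S / T] of [N]; the remaining
     fraction is supplied by the inner generators themselves. *)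
  exists (fun j => match j with
    | inl i => (1 - S / T) * l i | inr (i, j) => l i * l j / T end).
    case=> [i|[i j]]; rewrite !mulr_ge0 ?invr_ge0 ?(ltW T_gt0) //.
    by rewrite subr_ge0 ler_pdivrMr // mul1r.
  rewrite sumH.
  set N := \sum_(i | ~~ (0 < a (G i))) l i *: G i.
  set P := \sum_(i | 0 < a (G i)) l i *: G i.
  have -> : \sum_(i | ~~ (0 < a (G i))) ((1 - S / T) * l i) *: G i =
      (1 - S / T) *: N.
    by rewrite scaler_sumr; apply: eq_bigr => i _; rewrite scalerA.
  have -> : \sum_(i | 0 < a (G i)) \sum_(j | ~~ (0 < a (G j)))
      (l i * l j / T) *: (a (G i) *: G j - a (G j) *: G i) =
      (S / T) *: N + P.
    transitivity (\sum_(i | 0 < a (G i)) ((l i * a (G i) / T) *: N + l i *: G i)).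
      apply: eq_bigr => i ai.
      transitivity ((l i / T) *: (a (G i) *: N + T *: G i)); last first.
        by rewrite scalerDr !scalerA divfK // mulrAC.
      rewrite /N /T scaleNr scaler_suml scaler_sumr -sumrB scaler_sumr.
      apply: eq_bigr => j _; rewrite !scalerBr !scalerA.
      by congr (_ *: _ - _ *: _); ring.
    rewrite big_split /=; congr (_ + _).
    by rewrite -scaler_suml -mulr_suml.
  rewrite addrA -scalerDl subrK scale1r zE.
  by rewrite (bigID (fun i => 0 < a (G i))) /= addrC.
rewrite sumH; split.
  exists (fun i => if 0 < a (G i)
    then \sum_(j | ~~ (0 < a (G j))) l (inr (i, j)) * - a (G j)
    else l (inl i) + \sum_(j | 0 < a (G j)) l (inr (j, i)) * a (G j)).
    move=> i; case: ifPn => ai.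
      by apply: sumr_ge0 => j aj; rewrite mulr_ge0 // oppr_ge0 leNgt.
    by apply: addr_ge0 => //; apply: sumr_ge0 => j aj; rewrite mulr_ge0 // ltW.
  rewrite [RHS](bigID (fun i => 0 < a (G i))) /=.
  transitivity (\sum_(i | ~~ (0 < a (G i))) l (inl i) *: G i +
     (\sum_(i | 0 < a (G i)) \sum_(j | ~~ (0 < a (G j)))
       (l (inr (i, j)) * - a (G j)) *: G i +
      \sum_(i | ~~ (0 < a (G i))) \sum_(j | 0 < a (G j))
       (l (inr (j, i)) * a (G j)) *: G i)).
    congr (_ + _); rewrite [X in _ = _ + X]exchange_big /= -big_split /=.
    apply: eq_bigr => i ai; rewrite -big_split; apply: eq_bigr => j aj /=.
    by rewrite scalerBr !scalerA mulrN scaleNr addrC.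
  rewrite addrCA; congr (_ + _).
    by apply: eq_bigr => i ->; rewrite scaler_suml.
  rewrite -big_split; apply: eq_bigr => i /negPf ->.
  by rewrite scalerDl scaler_suml.
rewrite /= linearD !linear_sum /= -[leRHS]addr0.
apply: lerD; apply: sumr_le0 => i ai.
  by rewrite linearZ /= mulr_ge0_le0 // leNgt.
rewrite linear_sum sumr_le0 // => j aj.
by rewrite linearZ /= linearB !linearZ /= [a (G j) * _]mulrC subrr mulr0.
Qed.

(** Induction on the inequalities: the whole space is generated by the signed basis vectors, and
    each row cuts the cone by one half space. *)
Lemma polyhedral_cone_fg (R : realType) d p (A : 'M[R]_(p, d)) :
  exists (I : finType) (G : I -> 'cV[R]_d),
    [set z | forall i, (A *m z) i 0 <= 0] = cone_hull G.
Proof.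
elim: p A => [|p IHp] A.
  exists ('I_d * bool)%type.
  exists (fun i : 'I_d * bool => (-1) ^+ i.2 *: delta_mx i.1 0).
  apply/seteqP; split=> z _.
    (* The coefficients are the positive and negative parts of the coordinates. *)
    exists (fun i : 'I_d * bool => (`|z i.1 0| + (-1) ^+ i.2 * z i.1 0) / 2).
      move=> [i b] /=; rewrite divr_ge0 //.
      have := ler_norm (z i 0); have := ler_norm (- z i 0).
      by rewrite normrN; case: b; rewrite ?expr0 ?expr1; lra.
    rewrite -(pair_big_dep xpredT (fun _ _ => true)
      (fun i (b : bool) => ((`|z i 0| + (-1) ^+ b * z i 0) / 2) *:
        ((-1) ^+ b *: delta_mx i 0))) /=.
    rewrite [LHS]matrix_sum_delta; apply: eq_bigr => i _.
    rewrite big_ord1 big_bool /= expr0 expr1 !scalerA -scalerDl.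
    by congr (_ *: _); field.
  by case.
have [I [G GE]] := IHp (dsubmx (A : 'M_(1 + p, d))).
pose h (z : 'cV[R]_d) : R^o := (usubmx (A : 'M_(1 + p, d)) *m z) 0 0.
have lin : linear h.
  by rewrite /h; move=> c u v; rewrite mulmxDr -scalemxAr !mxE.
pose f : {scalar 'cV[R]_d} :=
  HB.pack h (GRing.isLinear.Build _ _ _ _ _ lin).
have [J [H HE]] := cone_hull_halfspace f G.
exists J, H; rewrite -HE -GE; apply/seteqP; split=> z; rewrite /= /h.
  by move=> Az; split=> [i|]; rewrite ?mul_dsub_mx ?mul_usub_mx mxE;
    exact: Az.
move=> [dz uz] i; have [j ->|j ->] := split_ordP (i : 'I_(1 + p)).
  by move: uz; rewrite mul_usub_mx mxE ord1.
by move: (dz j); rewrite mul_dsub_mx mxE.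
Qed.

(** The generators are those of the cone of all [(a, g)] with [0 <= a] and [P g <= a r], whose slice
    [a = 1] is [S]. The weight [s i] is the first coordinate of a generator: positive for a multiple
    of a point of [S], zero for a recession direction. The renormalised ray in the second clause
    treats both kinds alike. *)
Lemma polyhedral_generators (R : realType) n (S : set 'cV[R]_n) : polyhedral S ->
  exists (I : finType) (s : I -> R) (G : I -> 'cV[R]_n),
  [/\ forall i, 0 <= s i,
      forall i g t, S g -> 0 <= t -> S ((1 + t * s i)^-1 *: (g + t *: G i)) &
      forall g, S g -> exists2 l : I -> R, (forall i, 0 <= l i) &
        \sum_i l i * s i = 1 /\ g = \sum_i l i *: G i].
Proof.
case=> p [P [r ->]].
have [I [G GE]] := polyhedral_cone_fg
  (block_mx (-1) 0 (- r) P : 'M[R]_(1 + p, 1 + n)).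
have coneP (a : 'M[R]_1) (g : 'cV_n) : cone_hull G (col_mx a g) <->
    0 <= a 0 0 /\ forall i, (P *m g) i 0 <= a 0 0 * r i 0.
  rewrite -GE /= mul_block_col mul0mx addr0 mulNmx mul1mx.
  have e i : ((- r) *m a + P *m g) i 0 = (P *m g) i 0 - a 0 0 * r i 0.
    by rewrite mulNmx addrC !mxE big_ord1 mulrC.
  split=> [h|[a0 h] i].
    split=> [|i].
      by have := h (lshift p 0); rewrite col_mxEu !mxE oppr_le0.
    by have := h (rshift 1 i); rewrite col_mxEd e subr_le0.
  have [j ->|j ->] := split_ordP i.
    by rewrite col_mxEu ord1 !mxE oppr_le0.
  by rewrite col_mxEd e subr_le0.
have GP i : 0 <= usubmx (G i) 0 0 /\
    forall j, (P *m dsubmx (G i)) j 0 <= usubmx (G i) 0 0 * r j 0.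
  by apply/coneP; rewrite vsubmxK; exact: mem_cone_hull.
exists I, (fun i => usubmx (G i) 0 0), (fun i => dsubmx (G i)); split.
- by move=> i; have [] := GP i.
- move=> i g t /= Sg t0 j; have [s0 sG] := GP i.
  have c0 : 0 < 1 + t * usubmx (G i) 0 0 by rewrite ltr_wpDr // mulr_ge0.
  rewrite -scalemxAr mxE ler_pdivrMl // mulmxDr -scalemxAr mxE [X in _ + X]mxE.
  by rewrite mulrDl mul1r lerD // -mulrA ler_wpM2l.
move=> g /= Sg; have : cone_hull G (col_mx 1 g).
  by apply/coneP; rewrite mxE; split=> [//|i]; rewrite mul1r.
case=> l l0 lE; exists l => //; split.
  have := congr1 (fun z => (usubmx z) 0 0) lE.
  rewrite col_mxKu mxE linear_sum summxE => /esym; rewrite mulr1n => <-.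
  by apply: eq_bigr => i _; rewrite linearZ /= [in RHS]mxE.
have := congr1 dsubmx lE; rewrite col_mxKd => ->.
by rewrite linear_sum; apply: eq_bigr => i _; rewrite linearZ.
Qed.

(** * Following tight constraints *)

Lemma quad_pos_root (R : realType) (c b k : R) :
  c < 0 -> 0 <= k -> (0 < k) || (0 < b) ->
  exists2 a, 0 < a & c + b * a + k * a ^+ 2 = 0 /\
    forall s, 0 <= s <= a -> c + b * s + k * s ^+ 2 <= 0.
Proof.
move=> c0 k0 kb.
suff [a a0 ra] : exists2 a, 0 < a & c + b * a + k * a ^+ 2 = 0.
  exists a => //; split=> // s /andP[s0 sa].
  (* This is convexity on [[0, a]]: the value at [s] lies below the chord from [c < 0] to the
     root. *)
  have : (c + b * s + k * s ^+ 2) * a = (a - s) * c - k * s * a * (a - s)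
      + s * (c + b * a + k * a ^+ 2) by ring.
  rewrite ra mulr0 addr0 => e; rewrite -(pmulr_lle0 _ a0) e.
  have as0 : 0 <= a - s by rewrite subr_ge0.
  rewrite subr_le0; apply: (@le_trans _ _ 0); first by rewrite mulr_ge0_le0 // ltW.
  by rewrite !mulr_ge0 // ltW.
have [k_gt0|k_le0] := ltP 0 k.
  pose D := b ^+ 2 - 4 * k * c.
  have Db : b ^+ 2 < D by rewrite /D; nra.
  have D0 : 0 <= D by apply: le_trans (ltW Db); exact: sqr_ge0.
  have sD : Num.sqrt D ^+ 2 = D by rewrite sqr_sqrtr.
  have bD : b < Num.sqrt D.
    have := sqrtr_ge0 D; rewrite -sD in Db; nra.
  exists ((Num.sqrt D - b) / (2 * k)).
    by rewrite divr_gt0 ?subr_gt0 // mulr_gt0.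
  have k_neq0 : k != 0 by rewrite gt_eqF.
  have -> : c + b * ((Num.sqrt D - b) / (2 * k)) +
      k * ((Num.sqrt D - b) / (2 * k)) ^+ 2 =
      c + (Num.sqrt D ^+ 2 - b ^+ 2) / (4 * k) by field.
  by rewrite sD /D; field.
have {k_le0 k0} k0 : k = 0 by apply/le_anti/andP.
move: kb; rewrite k0 ltxx /= => b0; exists (- c / b).
  by rewrite divr_gt0 // oppr_gt0.
have b_neq0 : b != 0 by rewrite gt_eqF.
by field.
Qed.

(** The step [a] is the least positive root among the functions that start negative and eventually
    vanish. The remaining ones either are identically zero or are affine and nonincreasing, so they
    never become positive. *)
Lemma first_pos_root (R : realType) (I : finType) (c b k : I -> R) :
  (forall i, c i <= 0) -> (forall i, 0 <= k i) ->
  (forall i, c i = 0 -> b i = 0 /\ k i = 0) -> (exists i, 0 < k i) ->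
  exists2 a, 0 < a & (forall i, c i + b i * a + k i * a ^+ 2 <= 0) /\
    exists2 i, c i < 0 & c i + b i * a + k i * a ^+ 2 = 0.
Proof.
move=> c0 k0 ck [i0 ki0].
pose P i := (c i < 0) && ((0 < k i) || (0 < b i)).
have Pi0 : P i0.
  rewrite /P ki0 andbT lt_neqAle c0 andbT; apply/eqP => /ck[_ k00].
  by rewrite k00 ltxx in ki0.
have /choice[r rP] : forall i, exists a, P i ->
    0 < a /\ c i + b i * a + k i * a ^+ 2 = 0 /\
    forall s, 0 <= s <= a -> c i + b i * s + k i * s ^+ 2 <= 0.
  move=> i; have [Pi|nPi] := boolP (P i); last by exists 0.
  by case/andP: (Pi) => ci kb; have [a ? ?] := quad_pos_root ci (k0 i) kb; exists a.
case: (Order.TotalTheory.arg_minP r Pi0) => i Pi ri.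
have [ri0 [rootr rs]] := rP i Pi.
exists (r i) => //; split=> [j|]; last by exists i => //; case/andP: Pi.
have [Pj|] := boolP (P j).
  have [_ [_]] := rP j Pj; apply; rewrite (ltW ri0); exact: ri.
rewrite negb_and negb_or -!leNgt => /orP[cj|/andP[kj bj]].
  have cj0 : c j = 0 by apply/le_anti; rewrite c0.
  by have [-> ->] := ck j cj0; rewrite cj0 !mul0r !addr0.
have -> : k j = 0 by apply/le_anti; rewrite kj k0.
rewrite mul0r addr0 -[leRHS]addr0; apply: lerD => //.
by rewrite mulr_le0_ge0 // ltW.
Qed.

Lemma qevalD (R : realType) N (p : quadratic R N) x d (a : R) :
  qeval p (x + a *: d) = qeval p x +
    2 * (mxform (qmat p) x d + ((qvec p)^T *m d) 0 0) * a +
    mxform (qmat p) d d * a ^+ 2.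
Proof.
rewrite /qeval -!/(mxform _ _ _) -[x in mxform _ (x + _)]scale1r.
rewrite -[x in mxform _ _ (x + _)]scale1r mxform_sqr ?qmat_sym //.
by rewrite mulmxDr -scalemxAr !mxE; ring.
Qed.

(* A point with tight constraints [J] that admits a direction along which all of
   [J] stays tight lies strictly between two points having more tight
   constraints. *)
Lemma epigraph_tight_induction (R : realType) N (I : finType)
    (p : I -> quadratic R N) (s : I -> R) (C : set ('cV[R]_N * R^o)) :
  (forall i, 0 <= s i) -> (exists i, 0 < s i) ->
  (forall i, psd (qmat (p i))) ->
  (forall d, d != 0 -> exists i, 0 < mxform (qmat (p i)) d d) ->
  (forall z w (a : R), C z -> C w -> 0 < a < 1 -> C (a *: z + (1 - a) *: w)) ->
  (forall x (t t' : R), C (x, t) -> t <= t' -> C (x, t')) ->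
  (forall x (t : R), (forall i, qeval (p i) x <= 2 * s i * t) ->
    (exists2 i, 0 < s i & qeval (p i) x = 2 * s i * t) ->
    C (x, t) \/ exists (d : 'cV[R]_N) (u : R), d != 0 /\
      forall i, qeval (p i) x = 2 * s i * t ->
      qmat (p i) *m d = 0 /\ ((qvec (p i))^T *m d) 0 0 = s i * u) ->
  forall x (t : R), (forall i, qeval (p i) x <= 2 * s i * t) -> C (x, t).
Proof.
move=> s0 [i0 si0] psdp posp convC upC stepC.
(* Strong induction on the number of constraints that are not tight. *)
have tightC x (t : R) : (forall i, qeval (p i) x <= 2 * s i * t) ->
    (exists2 i, 0 < s i & qeval (p i) x = 2 * s i * t) -> C (x, t).
  have [n] := ubnP #|[set i | qeval (p i) x != 2 * s i * t]%SET|.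
  elim: n x t => // n IHn x t ltn Ext tight.
  have [//|[d [u [d0 dP]]]] := stepC x t Ext tight.
  have go (e : 'cV[R]_N) (v : R) : e != 0 ->
      (forall i, qeval (p i) x = 2 * s i * t ->
      qmat (p i) *m e = 0 /\ ((qvec (p i))^T *m e) 0 0 = s i * v) ->
      exists2 a : R, 0 < a & C (x + a *: e, t + a * v).
    move=> e0 eP.
    (* The left side of constraint [i] minus its right side, after a step [a] along [(e, v)], is
       [c i + b i * a + k i * a ^+ 2]. All three coefficients vanish for a tight constraint, which
       therefore stays tight. *)
    pose c i := qeval (p i) x - 2 * s i * t.
    pose b i := 2 * (mxform (qmat (p i)) x e + ((qvec (p i))^T *m e) 0 0)
      - 2 * s i * v.
    pose k i := mxform (qmat (p i)) e e.
    have cE a i : c i + b i * a + k i * a ^+ 2 =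
        qeval (p i) (x + a *: e) - 2 * s i * (t + a * v).
      by rewrite qevalD /c /b /k; ring.
    have ck i : c i = 0 -> b i = 0 /\ k i = 0.
      move=> /eqP; rewrite subr_eq0 => /eqP/eP[qe ve].
      by rewrite /b /k !mxform_mul0 // ve; split=> //; ring.
    have [||||a a0 [a_le [i ci ai]]] := @first_pos_root _ _ c b k.
    - by move=> i; rewrite subr_le0.
    - by move=> i; exact: (psdp i).2.
    - exact: ck.
    - exact: posp.
    exists a => //; apply: IHn.
    - rewrite ltnS in ltn; apply: leq_trans ltn; apply: proper_card.
      apply/properP; split.
        apply/fintype.subsetP => j; rewrite !inE; apply: contraNN => /eqP qj.
        have cj : c j = 0 by rewrite /c qj subrr.
        by rewrite -subr_eq0 -cE; have [-> ->] := ck j cj; rewrite cj !mul0r !addr0.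
      exists i; rewrite !inE -subr_eq0; first by rewrite -/(c i) lt_eqF.
      by rewrite -cE ai negbK.
    - by move=> j; rewrite -subr_le0 -cE.
    - case: tight => j sj qj; exists j => //; apply/eqP.
      have cj : c j = 0 by rewrite /c qj subrr.
      by rewrite -subr_eq0 -cE; have [-> ->] := ck j cj; rewrite cj !mul0r !addr0.
  have [a a0 Ca] := go d u d0 dP.
  have [||b b0 Cb] := go (- d) (- u).
  - by rewrite oppr_eq0.
  - by move=> i /dP[qd vd]; rewrite !mulmxN qd oppr0 mxE vd mulrN.
  have ab_neq0 : a + b != 0 by rewrite gt_eqF // addr_gt0.
  (* With weights [b / (a + b)] and [a / (a + b)] the displacements [a *: d] and [- b *: d]
     cancel. *)
  have := convC _ _ (b / (a + b)) Ca Cb; rewrite divr_gt0 ?addr_gt0 //.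
  rewrite ltr_pdivrMr ?addr_gt0 // mul1r ltrDr a0 => /(_ isT).
  set z := (X in C X -> _); suff -> : z = (x, t) by [].
  rewrite /z; apply/pair_equal_spec; split=> /=.
    by apply/matrixP => i j; rewrite !mxE; field.
  by rewrite /GRing.scale /=; field.
move=> x t Ext.
(* The value of [t] is lowered to the least one allowed by the constraints with [s i > 0], so that
   one of them becomes tight; those with [s i = 0] do not involve [t]. Upward closure of [C] then
   restores [t]. *)
case: (@Order.TotalTheory.arg_maxP _ _ _ i0 (fun i => 0 < s i)
  (fun i => qeval (p i) x / (2 * s i)) si0) => i si qi.
pose t' := qeval (p i) x / (2 * s i).
have t't : t' <= t.
  by rewrite /t' ler_pdivrMr ?mulr_gt0 // mulrC.
apply: upC t't; apply: tightC => [j|]; last first.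
  by exists i => //; rewrite /t' mulrC divfK // mulf_neq0 // gt_eqF.
have [sj|sj] := ltP 0 (s j).
  by have := qi j sj; rewrite -/t' /= ler_pdivrMr ?mulr_gt0 // mulrC.
have sj0 : s j = 0 by apply/le_anti; rewrite sj s0.
by have := Ext j; rewrite sj0 mulr0 !mul0r.
Qed.

(** * Kronecker structure *)

Lemma kron_id_sym_lin (R : realType) N k n (e : (k * n)%N = N) (A B : 'M[R]_N)
    (a : R) :
  kron_id_sym e A -> kron_id_sym e B -> kron_id_sym e (A + a *: B).
Proof.
case: N / e A B => A B [A' sA ->] [B' sB ->]; exists (A' + a *: B').
  by rewrite linearD linearZ /= sA sB.
rewrite !castmx_id; apply/matrixP => i j.
by rewrite /tensmx !mxE mulrDr mulrCA.
Qed.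

(** If [B] kills [y != 0], the kernel of the Kronecker product of the identity with [B] contains the
    [k]-dimensional column space of the identity tensored with [y]. Orthogonality to [V] imposes
    fewer than [k] linear conditions on it. *)
Lemma kron_kernel_orthogonal (R : realType) N k n (e : (k * n)%N = N)
    (A : 'M[R]_N) (x : 'cV[R]_N) (V : {vspace 'cV[R]_N}) :
  kron_id_sym e A -> x != 0 -> A *m x = 0 -> (\dim V < k)%N ->
  exists2 d : 'cV[R]_N, d != 0 &
    A *m d = 0 /\ forall v, v \in V -> (v^T *m d) 0 0 = 0.
Proof.
case: N / e A x V => A x V [B sB ->] x0; rewrite castmx_id => Ax Vk.
have k0 : k != 0%N by rewrite -lt0n (leq_ltn_trans _ Vk).
have n0 : n != 0%N.
  apply: contraNneq x0 => n0; apply/eqP/matrixP => i j.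
  have h := leq_ltn_trans (leq0n i) (ltn_ord i).
  by exfalso; move: h; rewrite n0 muln0.
have [y y0 By] : exists2 y : 'cV[R]_n, y != 0 & B *m y = 0.
  have : B \notin unitmx.
    apply: contra x0 => uB.
    have uA := tensmx_unit k0 n0 (unitmx1 R k) uB.
    by rewrite -[x](mulKmx uA) Ax mulmx0.
  rewrite -row_free_unit -kermx_eq0 => /rowV0Pn[v /sub_kermxP vB v0].
  exists v^T; first by rewrite trmx_eq0.
  by rewrite -[LHS]trmxK trmx_mul trmxK sB vB trmx0.
(* A left inverse of [y] yields the left inverse [L] of [M], so [M] is injective and the vector
   built from [c != 0] is nonzero. *)
have [l ly] : exists l : 'rV[R]_n, l *m y = 1%:M.
  have /cV0Pn[i yi] := y0.
  exists ((y i 0)^-1 *: delta_mx 0 i); rewrite -scalemxAl -rowE.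
  by apply/matrixP => a b; rewrite !ord1 !mxE mulVf.
pose M := (1%:M : 'M[R]_k) *t y; pose L := (1%:M : 'M[R]_k) *t l.
have AM : (1%:M *t B) *m M = 0 by rewrite tensmx_mul By tensmx0.
have LM : L *m M = 1%:M.
  rewrite tensmx_mul mulmx1 ly tens_mx_scalar scale1r.
  by apply/matrixP => i j; rewrite castmxE !mxE.
(* The rows of [W] form a basis of [V]; [c] exists because the rank of [W *m M] is at most
   [\dim V < k]. *)
pose W : 'M[R]_(\dim V, k * n) := \matrix_(i, j) (vbasis V)`_i j 0.
have [c c0 Wc] : exists2 c : 'rV[R]_(k * 1), c != 0 & c *m (W *m M)^T = 0.
  have : kermx (W *m M)^T != 0.
    rewrite -mxrank_eq0 mxrank_ker -lt0n subn_gt0.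
    by apply: leq_ltn_trans (rank_leq_col _) _; rewrite muln1.
  by move=> /rowV0Pn[v /sub_kermxP vB v0]; exists v.
have WMc : W *m (M *m c^T) = 0.
  by rewrite mulmxA -[LHS]trmxK trmx_mul trmxK Wc trmx0.
exists (M *m c^T).
  apply: contra c0 => /eqP Mc; rewrite -trmx_eq0 -[c^T]mul1mx -LM -mulmxA Mc.
  by rewrite mulmx0.
split=> [|v vV]; first by rewrite mulmxA AM mul0mx.
rewrite (coord_vbasis vV) linear_sum mulmx_suml summxE big1 // => i _.
rewrite linearZ /= -scalemxAl mxE; have /matrixP/(_ i 0) := WMc.
rewrite [RHS]mxE => WMci; rewrite -[RHS](mulr0 (coord (vbasis V) i v)) -WMci.
by rewrite !mxE; congr (_ * _); apply: eq_bigr => j _; rewrite !mxE.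
Qed.

(** * Lagrangians *)

Lemma ge0_of_ray (R : realType) (a b : R) :
  (forall t, 0 <= t -> 0 <= a + t * b) -> 0 <= b.
Proof.
move=> h; rewrite leNgt; apply/negP => b0.
have b_neq0 : b != 0 by rewrite lt_eqF.
have t0 : 0 <= (`|a| + 1) / - b by rewrite divr_ge0 ?addr_ge0 ?oppr_ge0 ?(ltW b0).
have := h _ t0; have -> : (`|a| + 1) / - b * b = - (`|a| + 1) by field.
by have := ler_norm a; lra.
Qed.

Lemma qcomb_sym (R : realType) N m (q0 : quadratic R N)
    (q : 'I_m -> quadratic R N) (s : R) (g : 'cV[R]_m)
    (A := s *: qmat q0 + \sum_i g i 0 *: qmat (q i)) :
  A^T = A.
Proof.
rewrite /A linearD linearZ /= qmat_sym linear_sum; congr (_ + _).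
by apply: eq_bigr => i _; rewrite linearZ /= qmat_sym.
Qed.

(* The Lagrangian of the multipliers [g], homogenised by the weight [s] of the
   objective: for [s = 1] its matrix is [Agamma g] and its vector [bgamma g]. *)
Definition qcomb (R : realType) N m (q0 : quadratic R N)
    (q : 'I_m -> quadratic R N) (s : R) (g : 'cV[R]_m) : quadratic R N :=
  Quadratic (s *: qvec q0 + \sum_i g i 0 *: qvec (q i))
    (s * qcst q0 + \sum_i g i 0 * qcst (q i)) (qcomb_sym q0 q s g).

Lemma qeval_qcomb (R : realType) N m (q0 : quadratic R N)
    (q : 'I_m -> quadratic R N) s g x :
  qeval (qcomb q0 q s g) x = s * qeval q0 x + \sum_i g i 0 * qeval (q i) x.
Proof.
rewrite /qeval /= -!/(mxform _ _ _) mxform_addm mxform_scalem mxform_summ.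
rewrite linearD linearZ /= mulmxDl -scalemxAl linear_sum /=.
rewrite mulmx_suml mxE mxE summxE.
rewrite mulrDr mulr_sumr.
rewrite [in RHS](eq_bigr (fun i => mxform (g i 0 *: qmat (q i)) x x +
    2 * ((g i 0 *: qvec (q i))^T *m x) 0 0 + g i 0 * qcst (q i))); last first.
  move=> i _; rewrite -/(mxform _ _ _) mxform_scalem linearZ /= -scalemxAl.
  rewrite [in RHS]mxE.
  by ring.
by rewrite !big_split /=; ring.
Qed.

Lemma qmat_qcomb1 (R : realType) N m (q0 : quadratic R N)
    (q : 'I_m -> quadratic R N) g :
  qmat (qcomb q0 q 1 g) = Agamma q0 q g.
Proof. by rewrite /= scale1r. Qed.

Lemma qmat_qcombD (R : realType) N m (q0 : quadratic R N)
    (q : 'I_m -> quadratic R N) s g a s' g' :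
  qmat (qcomb q0 q (s + a * s') (g + a *: g')) =
  qmat (qcomb q0 q s g) + a *: qmat (qcomb q0 q s' g').
Proof.
rewrite /= scalerDl scalerDr scalerA addrACA; congr (_ + _).
rewrite scaler_sumr -big_split; apply: eq_bigr => i _ /=.
by rewrite !mxE scalerDl scalerA.
Qed.

Lemma qvec_qcombD (R : realType) N m (q0 : quadratic R N)
    (q : 'I_m -> quadratic R N) s g a s' g' :
  qvec (qcomb q0 q (s + a * s') (g + a *: g')) =
  qvec (qcomb q0 q s g) + a *: qvec (qcomb q0 q s' g').
Proof.
rewrite /= scalerDl scalerDr scalerA addrACA; congr (_ + _).
rewrite scaler_sumr -big_split; apply: eq_bigr => i _ /=.
by rewrite !mxE scalerDl scalerA.
Qed.

Lemma qeval_qcombD (R : realType) N m (q0 : quadratic R N)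
    (q : 'I_m -> quadratic R N) s g a s' g' x :
  qeval (qcomb q0 q (s + a * s') (g + a *: g')) x =
  qeval (qcomb q0 q s g) x + a * qeval (qcomb q0 q s' g') x.
Proof.
rewrite !qeval_qcomb mulrDl (mulrDr a) mulrA addrACA; congr (_ + _).
rewrite mulr_sumr -big_split; apply: eq_bigr => i _ /=.
by rewrite !mxE mulrDl mulrA.
Qed.

Lemma Agamma_qcomb (R : realType) N m (q0 : quadratic R N)
    (q : 'I_m -> quadratic R N) s g : s != 0 ->
  Agamma q0 q (s^-1 *: g) = s^-1 *: qmat (qcomb q0 q s g).
Proof.
move=> s0; rewrite /Agamma /= scalerDr scalerA mulVf // scale1r scaler_sumr.
by congr (_ + _); apply: eq_bigr => i _; rewrite !mxE scalerA.
Qed.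

Lemma bgamma_qcomb (R : realType) N m (q0 : quadratic R N)
    (q : 'I_m -> quadratic R N) s g : s != 0 ->
  bgamma q0 q (s^-1 *: g) = s^-1 *: qvec (qcomb q0 q s g).
Proof.
move=> s0; rewrite /bgamma /= scalerDr scalerA mulVf // scale1r scaler_sumr.
by congr (_ + _); apply: eq_bigr => i _; rewrite !mxE scalerA.
Qed.

Lemma qeval_qcombZ (R : realType) N m (q0 : quadratic R N)
    (q : 'I_m -> quadratic R N) s g x : s != 0 ->
  qeval (qcomb q0 q 1 (s^-1 *: g)) x = s^-1 * qeval (qcomb q0 q s g) x.
Proof.
move=> s0; rewrite !qeval_qcomb (mulrDr s^-1) mulrA mulVf // mul1r mulr_sumr.
by congr (_ + _); apply: eq_bigr => i _; rewrite !mxE mulrA.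
Qed.

(** Isolates the Schur complement [X - x *m x^T]. By [psd_trace_ge0] the trace term is nonnegative
    when both factors are semidefinite, which is the source of weak duality. *)
Lemma mxdot_qhom (R : realType) N (p : quadratic R N) x (X : 'M[R]_N) :
  mxdot (qhom p) (block_mx 1%:M x^T x X) =
  qeval p x + \tr (qmat p *m (X - x *m x^T)).
Proof.
rewrite /mxdot /qhom tr_block_mx tr_scalar_mx trmxK qmat_sym.
rewrite mulmx_block mxtrace_block mulmx1 !linearD /=.
rewrite mulmxN linearN /= mxtrace_dyad.
rewrite mxtrace_scalar mulr1n [\tr (qvec p *m x^T)]mxtrace_mulC !trace_mx11.
have -> : (x^T *m qvec p) 0 0 = ((qvec p)^T *m x) 0 0.
  by rewrite -[x^T *m _]trmxK trmx_mul trmxK mxE.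
rewrite /qeval -/(mxform _ _ _); ring.
Qed.

Lemma mxdot_qcomb (R : realType) N m (q0 : quadratic R N)
    (q : 'I_m -> quadratic R N) s g x (X : 'M[R]_N) :
  let Y := block_mx 1%:M x^T x X in
  mxdot (qhom (qcomb q0 q s g)) Y =
  s * mxdot (qhom q0) Y + \sum_i g i 0 * mxdot (qhom (q i)) Y.
Proof.
rewrite /= !mxdot_qhom qeval_qcomb mulmxDl -scalemxAl linearD linearZ /=.
rewrite /= mulmx_suml linear_sum (mulrDr s (qeval q0 x)) addrACA; congr (_ + _).
rewrite -big_split; apply: eq_bigr => i _ /=.
by rewrite mxdot_qhom -scalemxAl linearZ (mulrDr (g i 0) (qeval (q i) x)).
Qed.

(** Completing the square: the block form is a square plus the form of the Schur complement, and a
    suitable first coordinate cancels the square. *)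
Lemma psd_schur (R : realType) N (x : 'cV[R]_N) (X : 'M[R]_N) : X^T = X ->
  psd (block_mx 1%:M x^T x X) <-> psd (X - x *m x^T).
Proof.
move=> sX.
have formE (a : R) (z : 'cV[R]_N) :
   mxform (block_mx 1%:M x^T x X) (col_mx a%:M z) (col_mx a%:M z) =
   (a + (x^T *m z) 0 0) ^+ 2 + mxform (X - x *m x^T) z z.
  have zx : (z^T *m x) 0 0 = (x^T *m z) 0 0.
    by rewrite -[z^T *m _]trmxK trmx_mul trmxK mxE.
  rewrite -scaleN1r mxform_addm mxform_scalem mxform_dyad /mxform.
  rewrite tr_col_mx mul_row_block mul_row_col mulmx1 !mulmxDl tr_scalar_mx.
  rewrite !mul_mx_scalar !mul_scalar_mx -!scalemxAl.
  rewrite mxE [X in X + _]mxE [X in _ + X]mxE.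
  by rewrite !(mxE scalemx_key) zx !mxE eqxx mulr1n; ring.
split=> [[_ pY]|[_ pZ]].
  split=> [|z]; first by rewrite linearB /= trmx_mul trmxK sX.
  have := pY (col_mx (- (x^T *m z) 0 0)%:M z).
  by rewrite -!/(mxform _ _ _) formE addNr expr0n add0r.
split=> [|z]; first by rewrite tr_block_mx trmxK sX tr_scalar_mx.
rewrite -/(mxform _ _ _) -[z]vsubmxK [usubmx z]mx11_scalar formE.
by rewrite addr_ge0 ?sqr_ge0 //; exact: pZ.
Qed.

(** * Epigraphs *)

Lemma convex_set_lmodP (R : realType) (E : lmodType R) (A : set E) :
  convex_set (A : set (convex_lmodType E)) <->
  forall x y (a : R), A x -> A y -> 0 <= a <= 1 -> A (a *: x + (1 - a) *: y).
Proof.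
split=> [cA x y a Ax Ay /andP[a0 a1]|cA x y a].
  by have := cA x y (Itv01 a0 a1) (mem_set Ax) (mem_set Ay); rewrite inE.
rewrite !inE => Ax Ay; apply: (cA x y a%:num) => //.
by apply/andP; split.
Qed.

(* The constraints are recovered by moving [g] along the coordinate axes inside
   [Gamma], in both directions where the sign conditions allow it. *)
Lemma definite_tight_epigraph (R : realType) N mI mE (q0 : quadratic R N)
    (q : 'I_(mI + mE) -> quadratic R N) g x (t : R) :
  Gamma q0 q g -> posdef (Agamma q0 q g) ->
  qeval (qcomb q0 q 1 g) x = 2 * t ->
  (forall g', Gamma q0 q g' -> qeval (qcomb q0 q 1 g') x <= 2 * t) ->
  epigraph q0 q (x, t).
Proof.
move=> [pg sg] pdg gt leg.
(* Positive definiteness absorbs any perturbation of size at most [e] along axis [i]. As [g] attains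
   the bound [2 * t], such a move cannot increase the Lagrangian. *)
have key (i : 'I_(mI + mE)) : exists2 e : R, 0 < e & forall c, `|c| <= e ->
    ((i < mI)%N -> 0 <= g i 0 + c) -> c * qeval (q i) x <= 0.
  have [e e0 eP] := posdef_dominates (qmat (q i)) pdg; exists e => // c ce ci.
  have Ac : Agamma q0 q (g + c *: delta_mx i 0) =
      Agamma q0 q g + c *: qmat (q i).
    have := qmat_qcombD q0 q 1 g c 0 (delta_mx i 0).
    rewrite mulr0 addr0 !qmat_qcomb1 => -> /=; rewrite scale0r add0r.
    congr (_ + _ *: _).
    rewrite (bigD1 i) //= big1 ?addr0 => [|j /negPf ji]; rewrite !mxE.
      by rewrite !eqxx scale1r.
    by rewrite ji scale0r.
  have : Gamma q0 q (g + c *: delta_mx i 0).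
    split=> [|j jI].
      rewrite Ac; split=> [|z]; first by rewrite linearD linearZ /= qmat_sym pg.1.
      rewrite -/(mxform _ _ _) mxform_addm mxform_scalem.
      have := eP z; have := ler_norm (- (c * mxform (qmat (q i)) z z)).
      rewrite normrN normrM => h1 h2.
      have : `|c| * `|mxform (qmat (q i)) z z| <= e * `|mxform (qmat (q i)) z z|.
        by rewrite ler_wpM2r.
      lra.
    rewrite !mxE eqxx andbT; case: eqP => [ji|_]; last by rewrite mulr0 addr0 sg.
    by rewrite mulr1 ji; apply: ci; rewrite -ji.
  have := qeval_qcombD q0 q 1 g c 0 (delta_mx i 0) x.
  rewrite mulr0 addr0 gt => gc /leg; rewrite gc gerDl qeval_qcomb mul0r add0r.
  rewrite (bigD1 i) //= big1 ?addr0.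
    by rewrite !mxE !eqxx mul1r.
  by move=> j /negPf ji; rewrite !mxE ji mul0r.
have le0 (i : 'I_(mI + mE)) : (i < mI)%N -> qeval (q i) x <= 0.
  move=> iI; have [e e0 eP] := key i; rewrite -(pmulr_rle0 _ e0); apply: eP.
    by rewrite ger0_norm // ltW.
  by move=> _; rewrite addr_ge0 ?sg // ltW.
have eq0 (i : 'I_(mI + mE)) : (mI <= i)%N -> qeval (q i) x = 0.
  move=> iI; have [e e0 eP] := key i; apply/le_anti/andP; split.
    rewrite -(pmulr_rle0 _ e0); apply: eP; first by rewrite ger0_norm // ltW.
    by rewrite ltnNge iI.
  rewrite -(nmulr_rle0 _ (_ : - e < 0)) ?oppr_lt0 //; apply: eP.
    by rewrite normrN ger0_norm // ltW.
  by rewrite ltnNge iI.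
(* Complementary slackness, which reduces the tight Lagrangian to [q0]. For an inequality with
   [g i 0 > 0], a decrease by at most [g i 0] is also allowed, whence the minimum with [e]. *)
have slack i : g i 0 * qeval (q i) x = 0.
  have [iI|iI] := leqP mI i; first by rewrite eq0 // mulr0.
  have [e e0 eP] := key i.
  have [->|gi0] := eqVneq (g i 0) 0; first by rewrite mul0r.
  have gi : 0 < g i 0 by rewrite lt_neqAle eq_sym gi0 sg.
  have m0 : 0 < Num.min e (g i 0) by rewrite lt_min e0.
  suff -> : qeval (q i) x = 0 by rewrite mulr0.
  apply/le_anti; rewrite le0 //= -(nmulr_rle0 _ (_ : - Num.min e (g i 0) < 0)).
    apply: eP; first by rewrite normrN ger0_norm ?(ltW m0) // ge_min lexx.
    by move=> _; rewrite subr_ge0 ge_min lexx orbT.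
  by rewrite oppr_lt0.
split; last by split.
move: gt; rewrite qeval_qcomb mul1r big1 => [|i _]; last exact: slack.
by rewrite addr0 => /= ->.
Qed.

Lemma epigraph_sub_sdp (R : realType) N mI mE (q0 : quadratic R N)
    (q : 'I_(mI + mE) -> quadratic R N) : epigraph q0 q `<=` epigraph_sdp q0 q.
Proof.
move=> [x t] [/= q0t [xI xE]]; exists (x *m x^T).
have sX : (x *m x^T)^T = x *m x^T by rewrite trmx_mul trmxK.
have dotE (p : quadratic R N) :
    mxdot (qhom p) (block_mx 1%:M x^T x (x *m x^T)) = qeval p x.
  by rewrite mxdot_qhom subrr mulmx0 linear0 addr0.
split=> //=; split.
- apply/psd_schur => //; rewrite subrr; split=> [|z]; first exact: trmx0.
  by rewrite mulmx0 mul0mx mxE.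
- by rewrite dotE.
- by move=> i iI; rewrite dotE xI.
- by move=> i iI; rewrite dotE xE.
Qed.

Lemma mxdotD (R : realType) n (Q Y Z : 'M[R]_n) (a b : R) :
  mxdot Q (a *: Y + b *: Z) = a * mxdot Q Y + b * mxdot Q Z.
Proof. by rewrite /mxdot mulmxDr -!scalemxAr linearD !linearZ. Qed.

Lemma convex_epigraph_sdp (R : realType) N mI mE (q0 : quadratic R N)
    (q : 'I_(mI + mE) -> quadratic R N) :
  convex_set (epigraph_sdp q0 q : set (convex_lmodType ('cV[R]_N * R^o)%type)).
Proof.
apply/convex_set_lmodP => -[x t] [y u] a [X [sX [pX /= X0 XI XE]]].
move=> [Y [sY [pY /= Y0 YI YE]]] /andP[a0 a1]; have b0 : 0 <= 1 - a.
  by rewrite subr_ge0.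
exists (a *: X + (1 - a) *: Y); split; first by rewrite linearD !linearZ /= sX sY.
have -> : block_mx 1%:M (a *: x + (1 - a) *: y)^T (a *: x + (1 - a) *: y)
    (a *: X + (1 - a) *: Y) =
    a *: block_mx 1%:M x^T x X + (1 - a) *: block_mx 1%:M y^T y Y.
  rewrite !scale_block_mx add_block_mx linearD !linearZ /=; congr block_mx.
  by rewrite -scalerDl addrC subrK scale1r.
split.
- split=> [|z].
    by rewrite linearD !linearZ /= pX.1 pY.1.
  rewrite -/(mxform _ _ _) mxform_addm !mxform_scalem.
  by rewrite addr_ge0 // mulr_ge0 //; [exact: pX.2|exact: pY.2].
- rewrite mxdotD /=; apply: le_trans (lerD (ler_wpM2l a0 X0) (ler_wpM2l b0 Y0)) _.
  by rewrite /GRing.scale /=; lra.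
- move=> i iI; rewrite mxdotD -[leRHS]addr0.
  by apply: lerD; rewrite mulr_ge0_le0 //; [exact: XI|exact: YI].
- by move=> i iI; rewrite mxdotD XE // YE // !mulr0 addr0.
Qed.

Lemma convex_hull_convex (R : realType) (E : lmodType R) (S : set E) x y (a : R) :
  convex_hull S x -> convex_hull S y -> 0 <= a <= 1 ->
  convex_hull S (a *: x + (1 - a) *: y).
Proof.
move=> Sx Sy a01 A [cA SA]; move/convex_set_lmodP: (cA); apply=> //.
  exact: Sx.
exact: Sy.
Qed.

Lemma convex_hull_epigraph_up (R : realType) N mI mE (q0 : quadratic R N)
    (q : 'I_(mI + mE) -> quadratic R N) x (t t' : R) :
  convex_hull (epigraph q0 q) (x, t) -> t <= t' ->
  convex_hull (epigraph q0 q) (x, t').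
Proof.
(* Points whose whole upward ray lies in the hull: [U] is convex and contains the epigraph, hence
   contains the hull. *)
pose U : set ('cV[R]_N * R^o) :=
  [set z | forall c : R, 0 <= c -> convex_hull (epigraph q0 q) (z.1, z.2 + c)].
suff /(_ (x, t)) hU : convex_hull (epigraph q0 q) `<=` U.
  move=> /hU /(_ (t' - t)) /=; rewrite [t + _]addrC subrK => h tt'.
  by apply: h; rewrite subr_ge0.
apply: smallest_sub.
  apply/convex_set_lmodP => -[y u] [z v] a Uy Uz a01 c c0.
  have := convex_hull_convex (Uy c c0) (Uz c c0) a01.
  congr (convex_hull _ _); apply/pair_equal_spec; split=> //=.
  by rewrite /GRing.scale /=; ring.
move=> [y u] [/= yu fy] c c0; apply: sub_gen_smallest; split=> //=.
by apply: le_trans yu _; rewrite ler_pM2l // lerDl.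
Qed.

(** * Faces of [Gamma] *)

Lemma qmat_qcomb_sum (R : realType) N m (q0 : quadratic R N)
    (q : 'I_m -> quadratic R N) (I : finType) (l s : I -> R) G :
  qmat (qcomb q0 q (\sum_i l i * s i) (\sum_i l i *: G i)) =
  \sum_i l i *: qmat (qcomb q0 q (s i) (G i)).
Proof.
elim/big_rec3: _ => [|i M g a _ <-].
  by rewrite /= scale0r add0r big1 // => j _; rewrite mxE scale0r.
by rewrite [X in qcomb _ _ X _]addrC [X in qcomb _ _ _ X]addrC qmat_qcombD addrC.
Qed.

Lemma qeval_qcomb_sum (R : realType) N m (q0 : quadratic R N)
    (q : 'I_m -> quadratic R N) (I : finType) (l s : I -> R) G x :
  qeval (qcomb q0 q (\sum_i l i * s i) (\sum_i l i *: G i)) x =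
  \sum_i l i * qeval (qcomb q0 q (s i) (G i)) x.
Proof.
elim/big_rec3: _ => [|i M g a _ <-].
  by rewrite qeval_qcomb mul0r add0r big1 // => j _; rewrite mxE mul0r.
by rewrite [X in qcomb _ _ X _]addrC [X in qcomb _ _ _ X]addrC qeval_qcombD addrC.
Qed.

(** Each renormalised ray from [g0] stays in [Gamma]. Letting [t] grow transfers the
    semidefiniteness and sign conditions to the direction [G i] itself, even when [s i = 0]. *)
Lemma Gamma_generators (R : realType) N mI mE (q0 : quadratic R N)
    (q : 'I_(mI + mE) -> quadratic R N) g0 :
  polyhedral (Gamma q0 q) -> Gamma q0 q g0 ->
  exists (I : finType) (s : I -> R) (G : I -> 'cV[R]_(mI + mE)),
  [/\ forall i, 0 <= s i, forall i, psd (qmat (qcomb q0 q (s i) (G i))),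
      forall i (j : 'I_(mI + mE)), (j < mI)%N -> 0 <= G i j 0 &
      forall g, Gamma q0 q g -> exists2 l : I -> R, (forall i, 0 <= l i) &
        \sum_i l i * s i = 1 /\ g = \sum_i l i *: G i].
Proof.
move=> /polyhedral_generators[I [s [G [s0 ray dec]]]] Gg0.
have st_gt0 i t : 0 <= t -> 0 < 1 + t * s i.
  by move=> t0; rewrite ltr_wpDr // mulr_ge0.
exists I, s, G; split=> // [i|i j jI].
  split=> [|z]; first exact: qmat_sym.
  apply: (@ge0_of_ray _ (mxform (Agamma q0 q g0) z z)) => t t0.
  have [[_ h] _] := ray i g0 t Gg0 t0; move: (h z).
  rewrite Agamma_qcomb ?gt_eqF ?st_gt0 // qmat_qcombD qmat_qcomb1.
  rewrite -!/(mxform _ _ _) mxform_scalem mxform_addm mxform_scalem.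
  by rewrite pmulr_rge0 // invr_gt0 st_gt0.
apply: (@ge0_of_ray _ (g0 j 0)) => t t0.
have [_ /(_ j jI)] := ray i g0 t Gg0 t0.
by rewrite !mxE pmulr_rge0 // invr_gt0 st_gt0.
Qed.

Lemma kron_id_sym_Agamma (R : realType) N k n (e : (k * n)%N = N) m
    (q0 : quadratic R N) (q : 'I_m -> quadratic R N) g :
  kron_id_sym e (qmat q0) -> (forall i, kron_id_sym e (qmat (q i))) ->
  kron_id_sym e (Agamma q0 q g).
Proof.
move=> k0 kq; rewrite /Agamma; elim/big_rec: _ => [|i M _ kM].
  by rewrite addr0.
by rewrite addrCA addrC; exact: kron_id_sym_lin.
Qed.

Lemma aff_direction_sub (R : realType) (E : vectType R) (S : set E) a b :
  S a -> S b -> a - b \in aff_direction S.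
Proof.
move=> Sa Sb; have [x xV] := aff_directionP (ex_intro _ a Sa).
have := sub_affine_hull Sa; have := sub_affine_hull Sb.
rewrite xV => -[v vV <-] [w wV <-].
by rewrite opprD addrACA subrr add0r; exact: memvB.
Qed.

(** For fixed [x] the Lagrangian is affine in the multiplier, so a proper convex combination reaches
    the upper bound [2 * t] only if both of its points do. *)
Lemma face_tight (R : realType) N mI mE (q0 : quadratic R N)
    (q : 'I_(mI + mE) -> quadratic R N) x (t : R) :
  (forall g, Gamma q0 q g -> qeval (qcomb q0 q 1 g) x <= 2 * t) ->
  face (Gamma q0 q)
    [set g | Gamma q0 q g /\ qeval (qcomb q0 q 1 g) x = 2 * t].
Proof.
move=> leg.
have conv a g h : qeval (qcomb q0 q 1 (a *: g + (1 - a) *: h)) x =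
    a * qeval (qcomb q0 q 1 g) x + (1 - a) * qeval (qcomb q0 q 1 h) x.
  have := qeval_qcombD q0 q a (a *: g) (1 - a) 1 h x.
  rewrite mulr1 [a + _]addrC subrK => ->; congr (_ + _).
  have := qeval_qcombD q0 q 0 0 a 1 g x; rewrite !add0r mulr1 => ->.
  rewrite [X in X + _]qeval_qcomb mul0r add0r big1 ?add0r // => i _.
  by rewrite mxE mul0r.
split=> [g []//||g h a Gg Gh /andP[a0 a1] [_ gh]].
  apply/convex_set_lmodP => g h a [[pg sg] gt] [[ph sh] ht] /andP[a0 a1].
  have b0 : 0 <= 1 - a by rewrite subr_ge0.
  split; last by rewrite conv gt ht; ring.
  split=> [|j jI]; last first.
    by rewrite !mxE addr_ge0 // mulr_ge0 //; [exact: sg|exact: sh].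
  have -> : Agamma q0 q (a *: g + (1 - a) *: h) =
      a *: Agamma q0 q g + (1 - a) *: Agamma q0 q h.
    rewrite /Agamma !scalerDr addrACA -scalerDl [a + _]addrC subrK scale1r.
    congr (_ + _); rewrite !scaler_sumr -big_split; apply: eq_bigr => i _ /=.
    by rewrite !mxE [LHS]scalerDl !scalerA.
  by apply: psd_add; exact: psd_scale.
move: gh (leg g Gg) (leg h Gh); rewrite conv.
set u := qeval (qcomb q0 q 1 g) x; set v := qeval (qcomb q0 q 1 h) x.
move=> uv u2 v2; have tu : 2 * t <= u by nra.
have tv : 2 * t <= v by nra.
by split; split=> //; apply/le_anti/andP; split.
Qed.

Lemma tight_direction (R : realType) N mI mE (q0 : quadratic R N)
    (q : 'I_(mI + mE) -> quadratic R N) k (I : finType) (s : I -> R)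
    (G : I -> 'cV[R]_(mI + mE)) x (t : R)
    (F := [set g | Gamma q0 q g /\ qeval (qcomb q0 q 1 g) x = 2 * t]) :
  kron_decomposable q0 q k ->
  (forall i, 0 <= s i) -> (forall i, psd (qmat (qcomb q0 q (s i) (G i)))) ->
  (forall i (j : 'I_(mI + mE)), (j < mI)%N -> 0 <= G i j 0) ->
  (exists2 i, 0 < s i & qeval (qcomb q0 q (s i) (G i)) x = 2 * s i * t) ->
  semidefinite q0 q F -> aff_dim (bgamma q0 q @` F) + 1 <= k%:Z ->
  exists (d : 'cV[R]_N) (u : R), d != 0 /\
    forall i, qeval (qcomb q0 q (s i) (G i)) x = 2 * s i * t ->
    qmat (qcomb q0 q (s i) (G i)) *m d = 0 /\
    ((qvec (qcomb q0 q (s i) (G i)))^T *m d) 0 0 = s i * u.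
Proof.
move=> [n [e [ke0 ke]]] s0 psdG sG [i0 si0 ti0] sdF dimF.
have memF a g : 0 < a -> psd (qmat (qcomb q0 q a g)) ->
    (forall j : 'I_(mI + mE), (j < mI)%N -> 0 <= g j 0) ->
    qeval (qcomb q0 q a g) x = 2 * a * t -> F (a^-1 *: g).
  move=> a0 pg sg gt; have a_neq0 : a != 0 by rewrite gt_eqF.
  split; last by rewrite qeval_qcombZ // gt; field.
  split=> [|j jI]; last by rewrite mxE mulr_ge0 ?invr_ge0 ?(ltW a0) ?sg.
  by rewrite Agamma_qcomb //; apply: psd_scale => //; rewrite invr_ge0 ltW.
(* The coefficients [l] select the tight generators. Their sum, divided by its weight [a > 0], is a
   point [gb] of [F], and any vector killed by its matrix is killed by the matrix of every tight
   generator. *)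
pose l i : R := (qeval (qcomb q0 q (s i) (G i)) x == 2 * s i * t)%:R.
have l0 i : 0 <= l i by exact: ler0n.
pose a := \sum_i l i * s i; pose g := \sum_i l i *: G i.
have a0 : 0 < a.
  rewrite /a (bigD1 i0) //= ltr_pwDl //; first by rewrite /l ti0 eqxx mul1r.
  by apply: sumr_ge0 => i _; rewrite mulr_ge0.
have a_neq0 : a != 0 by rewrite gt_eqF.
have Fg : F (a^-1 *: g).
  apply: memF => // [|j jI|].
  - by rewrite qmat_qcomb_sum; apply: psd_sum => i _; exact: psd_scale.
  - rewrite summxE; apply: sumr_ge0 => i _; rewrite mxE mulr_ge0 //.
    exact: sG.
  rewrite qeval_qcomb_sum mulrAC mulr_sumr; apply: eq_bigr => i _.
  by rewrite /l; case: eqP => [->|_]; rewrite ?mul1r ?mul0r ?mulr0 //; ring.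
set gb := a^-1 *: g in Fg.
have pgb : psd (Agamma q0 q gb) by case: Fg => -[].
have [|z z0 Az] := psd_nonposdef pgb.
  by move=> pd; apply: sdF; exists gb.
pose V := aff_direction (bgamma q0 q @` F).
have dV : (\dim V < k)%N.
  (* The image of [F] contains [bgamma q0 q gb], which rules out the value [-1] given by [aff_dim]
     to the empty set. *)
  move: dimF; rewrite /aff_dim; case: asboolP => [F0|_].
    have : (bgamma q0 q @` F) (bgamma q0 q gb) by exists gb.
    by rewrite F0.
  by rewrite -PoszD lez_nat addn1.
have [d d0 [Ad dVo]] :=
  kron_kernel_orthogonal (kron_id_sym_Agamma gb ke0 ke) z0 Az dV.
exists d, (((bgamma q0 q gb)^T *m d) 0 0); split=> // i ti.
split.
  apply: psd_kernel => //.
  (* The sum is a multiple of the form of [Agamma q0 q gb] at [d], hence zero; its terms are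
     nonnegative, so each vanishes. *)
  have : \sum_i l i * mxform (qmat (qcomb q0 q (s i) (G i))) d d == 0.
    rewrite (eq_bigr (fun i => mxform (l i *: qmat (qcomb q0 q (s i) (G i))) d d)).
      rewrite -mxform_summ -qmat_qcomb_sum -[qmat _](scalerKV a_neq0).
      by rewrite -Agamma_qcomb // mxform_scalem mxform_mul0 // mulr0.
    by move=> j _; rewrite mxform_scalem.
  rewrite psumr_eq0 => [/allP/(_ i (mem_index_enum _))|j _].
    by rewrite /l ti eqxx mul1r => /eqP.
  by rewrite mulr_ge0 //; exact: (psdG j).2.
(* A tight generator with [s i = 0] cannot be normalised to a point of [F]. Adding [gb] gives it the
   positive weight [s i + 1], and [d] is orthogonal to the difference of the two values of
   [bgamma]. *)
have c0 : 0 < s i + 1 * 1 by rewrite mulr1 ltr_wpDl.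
have Fi : F ((s i + 1 * 1)^-1 *: (G i + 1 *: gb)).
  case: Fg => -[_ sgb] tgb; apply: memF => // [|j jI|].
  - by rewrite qmat_qcombD scale1r qmat_qcomb1; exact: psd_add.
  - by rewrite mxE [X in _ + X]mxE mul1r addr_ge0 //; [exact: sG|exact: sgb].
  by rewrite qeval_qcombD ti tgb; ring.
have /dVo : bgamma q0 q ((s i + 1 * 1)^-1 *: (G i + 1 *: gb)) -
    bgamma q0 q gb \in V.
  apply: aff_direction_sub; last by exists gb.
  by exists ((s i + 1 * 1)^-1 *: (G i + 1 *: gb)).
rewrite bgamma_qcomb ?gt_eqF // qvec_qcombD scale1r.
have -> : qvec (qcomb q0 q 1 gb) = bgamma q0 q gb by rewrite /= scale1r.
rewrite linearB linearZ linearD /= mulmxBl -scalemxAl mulmxDl.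
move: (_ *m d) (_ *m d) => v w; rewrite !mxE mulr1.
have c_neq0 : s i + 1 != 0 by rewrite -[X in _ + X]mulr1 gt_eqF.
move=> /eqP; rewrite subr_eq0 => /eqP/(congr1 ( *%R (s i + 1))).
by rewrite mulVKf // mulrDl mul1r => /addIr.
Qed.

Theorem theorem2 (R : realType) (N mI mE : nat) (q0 : quadratic R N)
    (q : 'I_(mI + mE) -> quadratic R N) (k : nat)
    (hN : (1 <= N)%N) (hm : (1 <= mI + mE)%N)
    (hk : is_quad_eig_mult q0 q k)
    (hfeas : feasible q !=set0)
    (hdef : exists g : 'cV[R]_(mI + mE),
       (forall i : 'I_(mI + mE), (i < mI)%N -> 0 <= g i 0) /\
       posdef (Agamma q0 q g))
    (hpoly : polyhedral (Gamma q0 q))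
    (hface : forall F : set 'cV[R]_(mI + mE),
       face (Gamma q0 q) F -> semidefinite q0 q F ->
       aff_dim (bgamma q0 q @` F) + 1 <= k%:Z) :
  convex_hull (epigraph q0 q) = epigraph_sdp q0 q.
Proof.
apply/seteqP; split.
  by apply: smallest_sub; [exact: convex_epigraph_sdp|exact: epigraph_sub_sdp].
move=> [x t] [X [sX [/= pY Y0 YI YE]]].
have [g0 [sg0 pdg0]] := hdef.
have Gg0 : Gamma q0 q g0.
  split=> //; split=> [|z]; first by case: pdg0.
  have [->|z0] := eqVneq z 0; first by rewrite mulmx0 mxE.
  exact/ltW/pdg0.2.
have [I [s [G [s0 psdG sG dec]]]] := Gamma_generators hpoly Gg0.
(* The positive definite [Agamma q0 q g0] is a nonnegative combination of the generator matrices, so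
   these cannot all vanish at [d]. *)
have posG (d : 'cV[R]_N) : d != 0 ->
    exists i, 0 < mxform (qmat (qcomb q0 q (s i) (G i))) d d.
  move=> d0; apply: contrapT => nG; have [l l0 [ls lG]] := dec _ Gg0.
  have := pdg0.2 d d0; rewrite -/(mxform _ _ _) -qmat_qcomb1 lG -ls.
  rewrite qmat_qcomb_sum mxform_summ; apply/negP; rewrite -leNgt.
  apply: sumr_le0 => i _; rewrite mxform_scalem mulr_ge0_le0 // leNgt.
  by apply/negP => Gi; apply: nG; exists i.
apply: (@epigraph_tight_induction _ _ _ (fun i => qcomb q0 q (s i) (G i)) s) => //.
- have [l l0 [ls _]] := dec _ Gg0; apply: contrapT => ns.
  have /eqP : \sum_i l i * s i = 0.
    apply: big1 => i _; have [->|si] := eqVneq (s i) 0; first by rewrite mulr0.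
    by case: ns; exists i; rewrite lt_neqAle eq_sym si s0.
  by rewrite ls oner_eq0.
- by move=> z w a Cz Cw /andP[a0 a1]; apply: convex_hull_convex => //; rewrite !ltW.
- exact: convex_hull_epigraph_up.
- move=> {pY Y0 YI YE} y u Eyu tight.
  (* The generator inequalities combine, with total weight [1], into the bound for every multiplier
     in [Gamma]. *)
  have leG g : Gamma q0 q g -> qeval (qcomb q0 q 1 g) y <= 2 * u.
    move=> /dec[l l0 [ls ->]].
    have := qeval_qcomb_sum q0 q l s G y; rewrite ls => ->.
    have -> : 2 * u = \sum_i l i * (2 * s i * u).
      transitivity (2 * u * \sum_i l i * s i); first by rewrite ls mulr1.
      by rewrite mulr_sumr; apply: eq_bigr => i _; ring.
    by apply: ler_sum => i _; rewrite ler_wpM2l.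
  have [[g [Gg tg] pdg]|sd] := pselect (definite q0 q
      [set g | Gamma q0 q g /\ qeval (qcomb q0 q 1 g) y = 2 * u]).
    by left; apply: sub_gen_smallest; exact: definite_tight_epigraph Gg pdg tg leG.
  right; apply: tight_direction => //; first exact: hk.1.
  exact: hface (face_tight leG) sd.
(* Weak duality: the lifted matrix only increases each generator Lagrangian, and its constraint
   terms are nonpositive by the signs of [G i]. *)
move=> i /=; apply: (@le_trans _ _ (mxdot (qhom (qcomb q0 q (s i) (G i)))
    (block_mx 1%:M x^T x X))).
  rewrite mxdot_qhom lerDl; apply: psd_trace_ge0 => //.
  exact/psd_schur.
rewrite mxdot_qcomb -[leRHS]addr0; apply: lerD.
  by rewrite [2 * _]mulrC -mulrA ler_wpM2l.
apply: sumr_le0 => j _; have [jI|jI] := leqP mI j; first by rewrite YE // mulr0.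
by rewrite mulr_ge0_le0 ?sG // YI.
Qed.
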